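(* The family of mappings $(Q(t))_{t \geq 0}$ has the Feller and the e-property, that is: (i) Feller property: $Q(t)\psi \in C_{b}(V)$ for all $\psi \in C_{b}(V)$ (and all $t\ge 0$). (ii) e-property: for all $\psi \in \mathrm{Lip}_{b}(V)$, $v \in V$ and $\varepsilon>0$, there is a $\delta>0$ such that for all $\hat{v}\in V$ with $\|\hat{v}-v\|_{V}<\delta$ we have $|(Q(t)\psi)(v)-(Q(t)\psi)(\hat{v})|<\varepsilon$ for all $t \geq 0$. Moreover, the following assertions hold for any independent initial $x \in \mathcal{M}(\Omega;V)$: (iii) $(\mathbb{X}_{x}(t))_{t\geq 0}$ has almost surely càdlàg paths and is continuous in probability. (iv) The mapping $[0,\infty) \ni t \mapsto \mathbb{E}\psi(\mathbb{X}_{x}(t))$ is continuous whenever $\psi \in C_{b}(V)$; in particular, $(Q(\cdot)\psi)(v)$ is continuous for all $\psi \in C_{b}(V)$ and $v \in V$. (v) The filtration $(\mathcal{F}^{x}_{t})_{t\geq 0}$ fulfills the usual conditions, i.e. it is complete and right-continuous. (vi) The stochastic process $(\mathbb{X}_{x}(t))_{t\geq 0}$ is $(\mathcal{F}^{x}_{t})_{t\geq 0}$-progressive.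
   Context: $(\Omega,\mathcal{F},\mathbb{P})$ is a complete probability space, $(V,\|\cdot\|_V)$ is a separable real Banach space with Borel $\sigma$-algebra $\mathfrak{B}(V)$, and $\mathcal{M}(\Omega;V)$ is the set of all $V$-valued random variables ($\mathcal{F}$-$\mathfrak{B}(V)$-measurable maps). $\mathrm{BM}(V)$, $C_b(V)$, $\mathrm{Lip}_b(V)$ denote the spaces of functions $\psi:V\to\mathbb{R}$ that are bounded and measurable, bounded and continuous, bounded and Lipschitz continuous, respectively. A semigroup on $V$ is a family of (not necessarily linear) maps $T(t):V\to V$, $t\ge 0$, with $T(0)v=v$ and $T(t+h)v=T(t)T(h)v$ for all $t,h\ge0$, $v\in V$; it is time-continuous if $t\mapsto T(t)v$ is continuous on $[0,\infty)$ for every $v\in V$, and contractive if $\|T(t)v_1-T(t)v_2\|_V\le\|v_1-v_2\|_V$ for all $t\ge0$, $v_1,v_2\in V$. Standing assumptions: $(T(t))_{t\ge0}$ is a time-continuous, contractive semigroup on $V$; $(\eta_m)_{m\in\mathbb{N}}\subseteq\mathcal{M}(\Omega;V)$ is i.i.d.; $(\beta_m)_{m\in\mathbb{N}}$, $\beta_m:\Omega\to(0,\infty)$, is an i.i.d. sequence of exponentially distributed random variables with parameter $\theta\in(0,\infty)$; the two sequences are independent of each other. Set $\alpha_0:=0$, $\alpha_m:=\sum_{k=1}^m\beta_k$. An $x\in\mathcal{M}(\Omega;V)$ is an independent initial if $x$ is jointly independent of $((\eta_m)_{m\in\mathbb{N}},(\beta_m)_{m\in\mathbb{N}})$; every constant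 $v\in V$ is identified with the constant random variable and is an independent initial. For an independent initial $x$ set $\mathsf{x}_{x,0}:=x$, $\mathsf{x}_{x,m}:=T(\beta_m)\mathsf{x}_{x,m-1}+\eta_m$ for $m\in\mathbb{N}$, and $\mathbb{X}_x(t):=\sum_{m=0}^\infty T((t-\alpha_m)_+)(\mathsf{x}_{x,m})\mathbf{1}_{[\alpha_m,\alpha_{m+1})}(t)$ for $t\ge0$. $\mathcal{F}^x_t:=\sigma_0(\mathbb{X}_x(\tau);\tau\in[0,t])$, where $\sigma_0(\cdot)$ denotes the completion of the generated $\sigma$-algebra, i.e. all $A\in\mathcal{F}$ for which there is $B$ in the generated $\sigma$-algebra with $\mathbb{P}(A\Delta B)=0$. Finally $Q(t):\mathrm{BM}(V)\to\mathrm{BM}(V)$ is defined by $(Q(t)\psi)(v):=\mathbb{E}\psi(\mathbb{X}_v(t))$ for $t\ge0$, $v\in V$, $\psi\in\mathrm{BM}(V)$. *)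

(* Defs.v *)
From HB Require Import structures.
From mathcomp Require Import all_boot all_order all_algebra finmap.
From mathcomp Require Import all_classical all_reals all_analysis.
Import Order.TTheory GRing.Theory Num.Theory.
Import numFieldNormedType.Exports.

Set Implicit Arguments.
Unset Strict Implicit.
Unset Printing Implicit Defensive.

Local Open Scope classical_set_scope.
Local Open Scope ring_scope.

Definition separable (V : topologicalType) : Prop :=
  exists D : set V, countable D /\ dense D.

Notation borelType V := (g_sigma_algebraType (@open V)).

Definition Cb {R : realType} (V : normedModType R) : set (V -> R) :=
  [set psi | bounded_fun psi /\ continuous psi].

Definition Lipb {R : realType} (V : normedModType R) : set (V -> R) :=
  [set psi | bounded_fun psi /\ lipschitz psi].

(* A family indexed by [0, +oo[ is encoded as a function on R; its values at
   negative times are unconstrained and never used. *)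

Definition semigroup {R : realType} {V : normedModType R} (T : R -> V -> V) :=
  (forall v, T 0 v = v) /\
  (forall (t h : R) v, 0 <= t -> 0 <= h -> T (t + h) v = T t (T h v)).

Definition time_continuous {R : realType} {V : normedModType R}
    (T : R -> V -> V) :=
  forall v, {within `[0, +oo[, continuous (fun t : R => T t v)}.

Definition contractive {R : realType} {V : normedModType R}
    (T : R -> V -> V) :=
  forall (t : R) v1 v2, 0 <= t -> `|T t v1 - T t v2| <= `|v1 - v2|.

Definition sigma_gen {d d'} {Om : measurableType d} {U : measurableType d'}
    {I : Type} (D : set I) (Y : I -> Om -> U) : set (set Om) :=
  <<s \bigcup_(i in D) g_sigma_algebra_preimage (Y i) >>.

Definition independent_systems {d} {Om : measurableType d} {R : realType}
    (P : probability Om R) (G H : set (set Om)) :=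
  forall A B, G A -> H B -> (P (A `&` B) = P A * P B)%E.

Definition mutually_independent {d d'} {Om : measurableType d}
    {U : measurableType d'} {R : realType} (P : probability Om R)
    {I : choiceType} (Y : I -> Om -> U) :=
  forall (J : {fset I}) (A : I -> set Om),
    (forall i, i \in J -> g_sigma_algebra_preimage (Y i) (A i)) ->
    (P (\bigcap_(i in [set` J]) A i) = \prod_(i <- J) P (A i))%E.

Definition identically_distributed {d d'} {Om : measurableType d}
    {U : measurableType d'} {R : realType} (P : probability Om R)
    {I : Type} (Y : I -> {RV P >-> U}) :=
  forall i j A, measurable A ->
    distribution P (Y i) A = distribution P (Y j) A.

Definition iid {d d'} {Om : measurableType d} {U : measurableType d'}
    {R : realType} (P : probability Om R) {I : choiceType}
    (Y : I -> {RV P >-> U}) :=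
  mutually_independent P Y /\ identically_distributed Y.

Definition exponentially_distributed {d} {Om : measurableType d}
    {R : realType} (P : probability Om R) (theta : R) (b : {RV P >-> R}) :=
  forall A, measurable A -> distribution P b A = exponential_prob theta A.

(* Sequences indexed by the positive integers are shifted: [eta k] and [beta k]
   stand for eta_{k+1} and beta_{k+1}. *)

(* [x] is independent of the sigma-algebra generated by both sequences at once. *)
Definition independent_initial {d} {Om : measurableType d} {R : realType}
    {V : normedModType R} (P : probability Om R)
    (eta : nat -> {RV P >-> borelType V}) (beta : nat -> {RV P >-> R})
    (x : {RV P >-> borelType V}) :=
  independent_systems P (g_sigma_algebra_preimage x)
    <<s sigma_gen setT eta `|` sigma_gen setT beta >>.

Definition alpha {Om : Type} {R : realType} (beta : nat -> Om -> R) (m : nat)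
    (w : Om) : R :=
  \sum_(k < m) beta k w.

Fixpoint jump_chain {Om : Type} {R : realType} {V : normedModType R}
    (T : R -> V -> V) (eta : nat -> Om -> V) (beta : nat -> Om -> R)
    (x : Om -> V) (m : nat) (w : Om) : V :=
  if m is k.+1 then T (beta k w) (jump_chain T eta beta x k w) + eta k w
  else x w.

(* Since beta > 0, at most one term of the series is nonzero for each (t, w). If
   the jump times accumulate before t, all terms vanish and the value is 0. *)
Definition jump_process {Om : Type} {R : realType} {V : normedModType R}
    (T : R -> V -> V) (eta : nat -> Om -> V) (beta : nat -> Om -> R)
    (x : Om -> V) (t : R) (w : Om) : V :=
  limn (series (fun m =>
    (\1_(`[alpha beta m w, alpha beta m.+1 w[) t : R) *:
      T (Num.max (t - alpha beta m w) 0) (jump_chain T eta beta x m w))).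

Definition Q {d} {Om : measurableType d} {R : realType} {V : normedModType R}
    (P : probability Om R) (T : R -> V -> V) (eta : nat -> Om -> V)
    (beta : nat -> Om -> R) (t : R) (psi : V -> R) (v : V) : R :=
  fine 'E_P[fun w => psi (jump_process T eta beta (cst v) t w)].

Definition feller {R : realType} {V : normedModType R}
    (S : R -> (V -> R) -> V -> R) :=
  forall (t : R) psi, 0 <= t -> Cb psi -> Cb (S t psi).

Definition e_property {R : realType} {V : normedModType R}
    (S : R -> (V -> R) -> V -> R) :=
  forall psi v (eps : R), Lipb psi -> 0 < eps ->
    exists2 delta, 0 < delta &
      forall v', `|v' - v| < delta ->
        forall t : R, 0 <= t -> `|S t psi v - S t psi v'| < eps.

Definition cadlag {R : realType} {V : normedModType R} (f : R -> V) :=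
  (forall t : R, 0 <= t -> f s @[s --> t^'+] --> f t) /\
  (forall t : R, 0 < t -> cvg (f s @[s --> t^'-])).

Definition continuous_in_probability {d} {Om : measurableType d}
    {R : realType} {V : normedModType R} (P : probability Om R)
    (Y : R -> Om -> V) :=
  forall t eps : R, 0 <= t -> 0 < eps ->
    P [set w | eps < `|Y s w - Y t w|] @[s --> within `[0, +oo[ (nbhs t)]
      --> 0%E.

Definition sigma_completion {d} {Om : measurableType d} {R : realType}
    (P : probability Om R) (G : set (set Om)) : set (set Om) :=
  [set A | measurable A /\ exists2 B, G B & P (A `+` B) = 0%E].

Definition natural_filtration {d d'} {Om : measurableType d}
    {U : measurableType d'} {R : realType} (P : probability Om R)
    (Y : R -> Om -> U) (t : R) : set (set Om) :=
  sigma_completion P (sigma_gen `[0, t] Y).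

Definition filtration {d} {Om : measurableType d} {R : realType}
    (F : R -> set (set Om)) :=
  (forall t : R, 0 <= t -> sigma_algebra setT (F t) /\ F t `<=` measurable) /\
  (forall s t : R, 0 <= s -> s <= t -> F s `<=` F t).

Definition complete_filtration {d} {Om : measurableType d} {R : realType}
    (P : probability Om R) (F : R -> set (set Om)) :=
  forall t : R, 0 <= t -> P.-negligible `<=` F t.

Definition right_continuous_filtration {Om : Type} {R : realType}
    (F : R -> set (set Om)) :=
  forall t : R, 0 <= t -> F t = \bigcap_(s in `]t, +oo[) F s.

Definition usual_conditions {d} {Om : measurableType d} {R : realType}
    (P : probability Om R) (F : R -> set (set Om)) :=
  [/\ filtration F, complete_filtration P F & right_continuous_filtration F].

(* The trace on [0, t] x Om of the product of the Borel sets of R with [F t] is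
   the product of the Borel sets of [0, t] with [F t]. *)
Definition progressive {d d'} {Om : measurableType d} {U : measurableType d'}
    {R : realType} (F : R -> set (set Om)) (Y : R -> Om -> U) :=
  forall t : R, 0 <= t ->
    measurable_fun
      (`[0, t]%classic `*` setT : set (R * g_sigma_algebraType (F t)))
      (fun p => Y p.1 p.2).

(* Main.v *)
Require Import Defs.
From mathcomp Require Import all_boot all_order all_algebra finmap.
From mathcomp Require Import all_classical all_reals all_analysis.
From mathcomp Require Import measurable_realfun.
Import Order.TTheory GRing.Theory Num.Theory.
Import numFieldNormedType.Exports.

(** The process follows the flow T between its jump times, and these do not
depend on the starting point. Two processes driven by the same noise therefore
jump simultaneously by the same amounts, and contractivity of T keeps them
within the distance of their initial values, on every path and at every time
([jump_process_contractive]). Taking expectations gives the e-property with a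
delta that does not involve t, and the Feller property by dominated convergence.

Two almost sure facts about the exponential clock carry the rest. First, the
jump times tend to infinity ([alpha_unbounded]): if none exceeded c, all
waiting times would lie in [0, c], which for n of them has probability q ^ n
with q < 1. Second, no fixed time is a jump time ([alpha_no_atom]): the last
waiting time is independent of the preceding ones and its law has no atoms.
Hence a path is cadlag almost surely, and almost surely continuous at any given
time; dominated convergence turns the latter into continuity in probability and
continuity of expectations.

Right-continuity of the completed natural filtration is read off the paths.
Almost every path has no jump on some interval ]t, t + 1/(n+1)], and there it is
the image under the flow of its value at time t. So on the event that n is large
enough, an event of the sigma-algebra at time t + 1/(n+1) agrees with an event
B_n of the sigma-algebra at time t ([sigma_gen_trace]). An event which
belongs to all later sigma-algebras thus coincides almost surely with the limit
inferior of the B_n ([natural_filtration_right_continuous]).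

Finally, every single path is right-continuous, even an exploding one, since it
vanishes from its explosion time on. The process is thus the pointwise limit, on
the whole of [0, t] x Om, of step processes sampled at grid points to the right,
which makes it progressive with no exceptional set
([right_continuous_progressive]). *)

Set Implicit Arguments.
Unset Strict Implicit.
Unset Printing Implicit Defensive.

Local Open Scope classical_set_scope.
Local Open Scope ring_scope.

(** * Measurability of maps into a separable normed space *)

Lemma natSinv_lt {R : realType} (e : R) : 0 < e ->
  exists n : nat, n.+1%:R^-1 < e.
Proof.
move=> e0; have [n _ ne] := near_infty_natSinv_lt (PosNum e0).
by exists n; exact: ne (leqnn n).
Qed.

Lemma borel_measurableP {d} {Om : measurableType d} {R : realType}
    {V : normedModType R} (D : set Om) (f : Om -> V) :
  measurable D ->
  measurable_fun D (f : Om -> borelType V) <->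
  (forall U, open U -> measurable (D `&` f @^-1` U)).
Proof.
move=> mD; split=> [mf U oU|mf].
  by apply: mf => //; exact: sub_sigma_algebra.
apply: (@measurability _ _ Om (borelType V) D f (@open V)) => //.
by move=> _ [U oU <-]; exact: mf.
Qed.

Lemma continuous_borel_measurable {d} {Om : measurableType d} {R : realType}
    {V : normedModType R} (f : Om -> V) (psi : V -> R) :
  continuous psi -> measurable_fun setT (f : Om -> borelType V) ->
  measurable_fun setT (psi \o f).
Proof.
move=> cpsi /(borel_measurableP _ measurableT) mf.
apply: (measurability (@RGenOpens.G R)).
  exact: RGenOpens.measurableE.
move=> _ [_ [x [y ->]] <-]; rewrite comp_preimage; apply: mf.
by apply: open_comp => // v _; exact: cpsi.
Qed.

Lemma separable_sequence {R : realType} {V : normedModType R} :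
  separable V -> exists a : nat -> V,
    forall v (e : R), 0 < e -> exists n, `|v - a n| < e.
Proof.
move=> [D [cD dD]].
have [D0|/set0P[v0 Dv0]] := eqVneq D set0.
  have [] := dD setT; [by exists 0|exact: openT|].
  by move=> v [_]; rewrite D0.
have /pfcard_geP[D0|[g]] := cD; first by rewrite D0 in Dv0.
exists g => v e e0.
have [|u [vu Du]] := dD (ball v e) _ (ball_open v e).
  by exists v; exact: ballxx.
have [n _ gn] := @surj _ _ _ _ g _ Du.
by exists n; rewrite gn; move: vu; rewrite -ball_normE.
Qed.

Lemma separable_real (R : realType) : separable R.
Proof.
exists (range (@ratr R)); split; last exact: dense_rat.
by apply: sub_countable (countableP _); exact: card_image_le.
Qed.

(** Separability makes the Borel sigma-algebra of [A * B] the product one: an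
open set is the union of the countably many products of balls inside it that
have a centre in a dense sequence and a radius 1/(n+1). *)
Lemma measurable_comp2 {d} {Om : measurableType d} {R : realType}
    {A B C : normedModType R} (h : A * B -> C) (f : Om -> A) (g : Om -> B) :
  separable A -> separable B -> continuous h ->
  (forall U, open U -> measurable (f @^-1` U)) ->
  (forall U, open U -> measurable (g @^-1` U)) ->
  measurable_fun setT ((fun w => h (f w, g w)) : Om -> borelType C).
Proof.
move=> /separable_sequence[a da] /separable_sequence[b db] ch mf mg.
apply/borel_measurableP => // U oU; rewrite setTI.
pose r (n : nat) : R := n.+1%:R^-1.
have r0 n : 0 < r n by rewrite invr_gt0.
pose good i j n := ball (a i) (r n) `*` ball (b j) (r n) `<=` h @^-1` U.
rewrite (_ : _ @^-1` U = \bigcup_i \bigcup_j \bigcup_(n in good i j)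
   (f @^-1` ball (a i) (r n) `&` g @^-1` ball (b j) (r n))); last first.
  apply/seteqP; split=> w /=; last first.
    by move=> [i _ [j _ [n gn [fw gw]]]]; apply: (gn (f w, g w)).
  move=> Uw.
  have /nbhs_ballP[e /= e0 eU] : nbhs (f w, g w) (h @^-1` U).
    by apply: ch; exact: open_nbhs_nbhs.
  have [n ne] : exists n, r n < e / 2.
    by apply: natSinv_lt; rewrite divr_gt0.
  have [i ai] := da (f w) _ (r0 n); have [j bj] := db (g w) _ (r0 n).
  exists i => //; exists j => //; exists n; last first.
    by split; rewrite /= -ball_normE /= distrC.
  move=> [x y] /= [ax byy]; apply: eU; split => /=.
    apply: (@ball_splitr _ _ (a i)).
      by apply: le_ball (ltW ne) _ _; rewrite -ball_normE /= distrC.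
    exact: le_ball (ltW ne) _ ax.
  apply: (@ball_splitr _ _ (b j)).
    by apply: le_ball (ltW ne) _ _; rewrite -ball_normE /= distrC.
  exact: le_ball (ltW ne) _ byy.
do 3 (apply: bigcup_measurable => ? ?).
by apply: measurableI; [apply: mf|apply: mg]; exact: ball_open.
Qed.

(** A limit lies in the open set U iff, for some k, its approximants eventually
lie in the set of points whose 1/(k+1)-ball is inside U. That set need not be
open, so its interior is used: if the e-ball at f w is inside U and 1/(k+1) is
less than e/2, then the e/2-ball at f w lies in that set. *)
Lemma measurable_cvg_pointwise {d} {Om : measurableType d} {R : realType}
    {V : normedModType R} (D : set Om) (f_ : nat -> Om -> V) (f : Om -> V) :
  measurable D ->
  (forall n, measurable_fun D (f_ n : Om -> borelType V)) ->
  (forall w, D w -> f_ n w @[n --> \oo] --> f w) ->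
  measurable_fun D (f : Om -> borelType V).
Proof.
move=> mD mf_ ff; apply/borel_measurableP => // U oU.
pose r (n : nat) : R := n.+1%:R^-1.
have r0 n : 0 < r n by rewrite invr_gt0.
pose W k := interior [set y | ball y (r k) `<=` U].
rewrite (_ : D `&` _ = \bigcup_k \bigcup_N \bigcap_(n in [set n | (N <= n)%N])
    (D `&` f_ n @^-1` W k)); last first.
  apply/seteqP; split=> w /=.
    move=> [Dw Uw].
    have /nbhs_ballP[e /= e0 eU] : nbhs (f w) U by exact: open_nbhs_nbhs.
    have [k ke] : exists k, r k < e / 2.
      by apply: natSinv_lt; rewrite divr_gt0.
    have Wf : nbhs (f w) (W k).
      apply: open_nbhs_nbhs; split; first exact: open_interior.
      apply/nbhs_ballP; exists (e / 2) => [|y fy z yz]; rewrite /= ?divr_gt0//.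
      apply: eU.
      apply: (@ball_split _ _ y) => //; exact: le_ball (ltW ke) _ yz.
    have [N _ NW] := ff w Dw _ Wf.
    by exists k => //; exists N => // n Nn; split=> //; exact: NW.
  move=> [k _ [N _ NW]].
  have Dw : D w by have [] := NW N (leqnn N).
  split=> //.
  have [M _ MW] := ff w Dw _ (nbhsx_ballx _ _ (r0 k)).
  have /= [_ /interior_subset] := NW (maxn N M) (leq_maxl _ _).
  by apply; apply/ball_sym; apply: (MW _ (leq_maxr N M)).
apply: bigcup_measurable => k _; apply: bigcup_measurable => N _.
apply: bigcap_measurable => [|n _]; first by exists N => /=.
by have /borel_measurableP := mf_ n; apply => //; exact: open_interior.
Qed.

(** * Sequential limits and bounded expectations *)

Lemma cvg_within_sequences {R : realType} {A : normedModType R} (D : set A)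
    (f : A -> R) (a : A) (l : R) :
  (forall u : nat -> A, (forall n, D (u n)) -> u n @[n --> \oo] --> a ->
    f (u n) @[n --> \oo] --> l) ->
  f x @[x --> within D (nbhs a)] --> l.
Proof.
move=> fl; apply/cvgrPdist_lt => e e0; apply: contrapT => nfl.
have /choice[u uP] : forall n : nat, exists x,
    [/\ D x, `|a - x| < n.+1%:R^-1 & e <= `|l - f x|].
  move=> n; apply: contrapT => nx; apply: nfl.
  have n0 : 0 < n.+1%:R^-1 :> R by rewrite invr_gt0.
  apply: filterS (nbhsx_ballx a _ n0) => x; rewrite -ball_normE /= => ax Dx.
  by rewrite ltNge; apply/negP => ex; apply: nx; exists x.
have ua : u n @[n --> \oo] --> a.
  apply/cvgrPdist_lt => r r0; near=> n.
  have [_ /lt_trans-> //] := uP n.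
  near: n; exact: near_infty_natSinv_lt (PosNum r0).
have Du n : D (u n) by case: (uP n).
have /cvgrPdist_lt/(_ _ e0)[N _ /(_ N (leqnn N))] := fl u Du ua.
by rewrite ltNge /=; case: (uP N) => _ _ ->.
Unshelve. all: by end_near. Qed.

Lemma expectation_cvg_bounded {d} {Om : measurableType d} {R : realType}
    (P : probability Om R) (g_ : nat -> Om -> R) (g : Om -> R) (M : R) :
  (forall n, measurable_fun setT (g_ n)) -> measurable_fun setT g ->
  (forall n w, `|g_ n w| <= M) ->
  {ae P, forall w, g_ n w @[n --> \oo] --> g w} ->
  fine 'E_P[g_ n] @[n --> \oo] --> fine 'E_P[g].
Proof.
move=> mg_ mg gM gg; rewrite unlock.
have Mi : P.-integrable setT (EFin \o cst M : Om -> \bar R).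
  apply: measurable_bounded_integrable => //.
    exact: fin_num_fun_lty.
  by apply: bounded_cst.
have [||||gi _ gc] := @dominated_convergence _ Om R P setT measurableT
  (fun n => EFin \o g_ n) (EFin \o g) (EFin \o cst M) _ _ _ Mi _.
- by move=> n; exact/measurable_EFinP.
- exact/measurable_EFinP.
- by apply: filterS gg => w gw _; apply: cvg_EFin => //; exact: nearW.
- by apply: aeW => w n _ /=; rewrite lee_fin.
apply: fine_cvg; rewrite fineK//; last exact: integrable_fin_num.
Qed.

Lemma bounded_fun_normP {R : realType} {V : normedModType R} (f : V -> R) :
  bounded_fun f <-> exists M, forall v, `|f v| <= M.
Proof.
have FF : ProperFilter (globally [set: V]).
  exact: (@globally_properfilter _ _ (0 : V)).
split=> [bf|[M fM]].
  have [M fM] := (ex_bound (f : V -> R^o)).1 bf.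
  by exists M => v; exact: fM.
by apply: (ex_bound (f : V -> R^o)).2; exists M => v _; exact: fM.
Qed.

Lemma bounded_integrable {d} {Om : measurableType d} {R : realType}
    (P : probability Om R) (g : Om -> R) (M : R) :
  measurable_fun setT g -> (forall w, `|g w| <= M) ->
  P.-integrable setT (EFin \o g).
Proof.
move=> mg gM; apply: measurable_bounded_integrable => //.
  exact: fin_num_fun_lty.
exists M; split=> [|x Mx w _]; first exact: num_real.
exact: le_trans (gM w) (ltW Mx).
Qed.

Lemma expectation_dist_le {d} {Om : measurableType d} {R : realType}
    (P : probability Om R) (f g : Om -> R) (M c : R) :
  measurable_fun setT f -> measurable_fun setT g ->
  (forall w, `|f w| <= M) -> (forall w, `|g w| <= M) ->
  (forall w, `|f w - g w| <= c) ->
  `|fine 'E_P[f] - fine 'E_P[g]| <= c.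
Proof.
move=> mf mg fM gM fgc; rewrite unlock.
have fi := bounded_integrable P mf fM; have gi := bounded_integrable P mg gM.
have mfg : measurable_fun setT (f \- g) by exact: measurable_funB.
have fgi : P.-integrable setT (EFin \o (f \- g)).
  exact: bounded_integrable mfg fgc.
rewrite -(RintegralB measurableT fi gi).
rewrite (le_trans (le_normr_Rintegral measurableT fgi))//.
have -> : c = \int[P]_(x in setT) c.
  rewrite Rintegral_cst//; have := @probability_setT _ _ _ P.
  by move=> /= ->; rewrite mulr1.
apply: le_Rintegral => //.
- apply: (@bounded_integrable _ _ _ _ _ c) => [|w].
    exact: measurableT_comp.
  by rewrite /= normr_id; exact: fgc.
- by apply: (@bounded_integrable _ _ _ _ _ `|c|).
- by move=> w _; exact: fgc.
Qed.

(** * Paths of the jump process *)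

Section jump_paths.
Context {Om : Type} {R : realType} {V : normedModType R}.
Variables (T : R -> V -> V) (eta : nat -> Om -> V) (beta : nat -> Om -> R).
Hypothesis beta_gt0 : forall m w, 0 < beta m w.

Local Notation alpha := (alpha beta).
Local Notation chain x := (jump_chain T eta beta x).
Local Notation X x := (jump_process T eta beta x).

Lemma alpha0 w : alpha 0 w = 0.
Proof. by rewrite /alpha big_ord0. Qed.

Lemma alphaS m w : alpha m.+1 w = alpha m w + beta m w.
Proof. by rewrite /alpha big_ord_recr. Qed.

Lemma alpha_le m n w : (m <= n)%N -> alpha m w <= alpha n w.
Proof.
move=> /subnK <-; elim: (n - m)%N => [|k IH]; first by rewrite add0n.
by rewrite addSn alphaS (le_trans IH)// lerDl ltW.
Qed.

Lemma alpha_ge0 m w : 0 <= alpha m w.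
Proof. by rewrite -(alpha0 w); exact: alpha_le. Qed.

Lemma alpha_lt m w : alpha m w < alpha m.+1 w.
Proof. by rewrite alphaS ltrDl. Qed.

Lemma jump_interval_inj m n (t : R) w :
  alpha m w <= t < alpha m.+1 w -> alpha n w <= t < alpha n.+1 w -> m = n.
Proof.
move=> /andP[mt tm] /andP[nt tn]; apply/eqP; rewrite eqn_leq; apply/andP.
split; rewrite leqNgt; apply/negP => /(alpha_le w).
  by rewrite leNgt (le_lt_trans mt tn).
by rewrite leNgt (le_lt_trans nt tm).
Qed.

Lemma jump_interval_exists (t : R) w : 0 <= t ->
  (exists m, alpha m w <= t < alpha m.+1 w) \/ (forall m, alpha m w <= t).
Proof.
move=> t0; have [|noexpl] := pselect (forall m, alpha m w <= t); first by right.
left; apply: contrapT => nex; apply: noexpl.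
elim=> [|m IH]; first by rewrite alpha0.
by rewrite leNgt; apply/negP => tm; apply: nex; exists m; rewrite IH.
Qed.

Lemma jump_process_in x m (t : R) w : alpha m w <= t < alpha m.+1 w ->
  X x t w = T (t - alpha m w) (chain x m w).
Proof.
move=> mt; apply: lim_near_cst; first exact: norm_hausdorff.
exists m.+1 => // n /= mn; rewrite /series /= big_mkord.
rewrite (bigD1 (Ordinal mn))//= indicE mem_set ?scale1r; last first.
  by rewrite /= in_itv.
rewrite (max_idPl _) ?subr_ge0; last by case/andP: mt.
rewrite big1 ?addr0// => k /eqP km; rewrite indicE memNset ?scale0r//=.
rewrite in_itv/= => kt; apply: km; apply: val_inj => /=.
exact: jump_interval_inj kt mt.
Qed.

Lemma jump_process_out x (t : R) w :
  (forall m, ~ alpha m w <= t < alpha m.+1 w) -> X x t w = 0.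
Proof.
move=> nt; apply: lim_near_cst; first exact: norm_hausdorff.
apply: nearW => n; rewrite /series /= big1// => k _.
by rewrite indicE memNset ?scale0r//= in_itv /=; exact: nt.
Qed.

Lemma jump_process_exploded x (t : R) w :
  (forall m, alpha m w <= t) -> X x t w = 0.
Proof.
move=> wt; apply: jump_process_out => m /andP[_].
by rewrite ltNge wt.
Qed.

Hypothesis T_semigroup : semigroup T.
Hypothesis T_continuous : time_continuous T.
Hypothesis T_contractive : contractive T.

Lemma jump_chain_contractive x y m w :
  `|chain x m w - chain y m w| <= `|x w - y w|.
Proof.
elim: m => //= m IH; rewrite opprD addrACA subrr addr0.
by rewrite (le_trans _ IH)//; apply: T_contractive; exact: ltW.
Qed.

(** Both processes jump at the same times by the same amounts, so the increments
[eta] cancel in the difference. If the jump times accumulate before t, both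
processes are 0 at t. *)
Lemma jump_process_contractive x y (t : R) w : 0 <= t ->
  `|X x t w - X y t w| <= `|x w - y w|.
Proof.
move=> /(@jump_interval_exists t w)[[m mt]|wt]; last first.
  by rewrite !jump_process_exploded// subrr normr0.
rewrite !(jump_process_in _ mt) (le_trans _ (jump_chain_contractive x y m w))//.
by apply: T_contractive; rewrite subr_ge0; case/andP: mt.
Qed.

Lemma jump_process_flow x m (s t : R) w :
  alpha m w <= t -> t <= s -> s < alpha m.+1 w ->
  X x s w = T (s - t) (X x t w).
Proof.
move=> mt ts sm.
rewrite (@jump_process_in _ m s) ?(le_trans mt ts)//.
rewrite (@jump_process_in _ m t) ?mt ?(le_lt_trans ts sm)//.
by rewrite -T_semigroup.2 ?subr_ge0// addrA subrK.
Qed.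

(** Extending the flow to negative times by its value at 0 gives a map that is
continuous on the whole line, to which composition lemmas apply. *)
Lemma semigroup_continuous v : continuous (fun t : R => T (Num.max t 0) v).
Proof.
have /subspace_continuousP Tv := @T_continuous v.
move=> t.
have tmax : Num.max s 0 @[s --> t] --> within `[0, +oo[ (nbhs (Num.max t 0)).
  move=> A /= nA.
  have : continuous (fun s : R => Num.max s 0).
    by move=> s; apply: continuous_max; [exact: cvg_id|exact: cvg_cst].
  move=> /(_ t _ nA); rewrite /= !nbhs_simpl /=.
  apply: filterS => s; apply.
  by rewrite /= in_itv /= andbT le_max lexx orbT.
apply: cvg_comp tmax (Tv _ _).
by rewrite /= in_itv /= andbT le_max lexx orbT.
Qed.

Lemma flow_cvg v (a : R) (F : set_system R) (t : R) : Filter F ->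
  F --> t -> a <= t -> (\forall s \near F, a <= s) ->
  T (s - a) v @[s --> F] --> T (t - a) v.
Proof.
move=> FF Ft at_ Fa.
have -> : T (t - a) v = T (Num.max (t - a) 0) v.
  by rewrite (max_idPl _)// subr_ge0.
apply: (@cvg_trans _ ((fun s => T (Num.max (s - a) 0) v) @ F)).
  apply: near_eq_cvg; apply: filterS Fa => s sa.
  by rewrite (max_idPl _)// subr_ge0.
apply: (@cvg_comp _ _ _ (fun s : R => s - a)
  (fun s : R => T (Num.max s 0) v) F (nbhs (t - a))).
  by apply: cvgB => //; exact: cvg_cst.
exact: semigroup_continuous.
Qed.

(** This holds for every w: when no jump time exceeds t, the process is 0
on all of [t, +oo[. *)
Lemma jump_process_right_continuous x (t : R) w : 0 <= t ->
  X x s w @[s --> t^'+] --> X x t w.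
Proof.
move=> t0; have [[m mt]|wt] := jump_interval_exists w t0.
  have tm : t < alpha m.+1 w by case/andP: mt.
  have {}mt : alpha m w <= t by case/andP: mt.
  apply: (@cvg_trans _ ((fun s => T (s - t) (X x t w)) @ t^'+)).
    apply: near_eq_cvg; near=> s.
    by rewrite -(jump_process_flow x mt).
  have := @flow_cvg (X x t w) t t^'+ t _ (cvg_within _) (lexx t)
    (nbhs_right_ge t).
  by rewrite subrr T_semigroup.1; apply.
rewrite jump_process_exploded//; apply: cvg_near_cst; near=> s.
apply: jump_process_exploded => m; apply: (le_trans (wt m)).
by near: s; exact: nbhs_right_ge.
Unshelve. all: by end_near. Qed.

Lemma jump_process_left_limit x (t : R) w : 0 < t ->
  (exists m, t < alpha m w) -> cvg (X x s w @[s --> t^'-]).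
Proof.
move=> t0 [n tn].
have [m mt tm] : exists2 m, alpha m w < t & t <= alpha m.+1 w.
  elim: n tn => [|n IH] tn; first by move: tn; rewrite alpha0 ltNge ltW.
  have [/IH//|nt] := ltP t (alpha n w).
  move: nt; rewrite le_eqVlt => /predU1P[nt|nt]; last first.
    by exists n => //; exact: ltW.
  case: n nt {IH tn} => [|n] nt; first by rewrite -nt alpha0 ltxx in t0.
  by exists n; rewrite -?nt//; exact: alpha_lt.
apply/cvg_ex; exists (T (t - alpha m w) (chain x m w)).
apply: (@cvg_trans _ ((fun s => T (s - alpha m w) (chain x m w)) @ t^'-)).
  apply: near_eq_cvg; near=> s.
  rewrite (@jump_process_in x m)//; apply/andP; split.
    by near: s; exact: nbhs_left_ge.
  apply: lt_le_trans tm; near: s; exact: nbhs_left_lt.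
apply: flow_cvg; [exact: cvg_within|exact: ltW|exact: nbhs_left_ge].
Unshelve. all: by end_near. Qed.

Lemma jump_process_continuous x (t : R) w : 0 <= t ->
  (exists m, t < alpha m w) -> (forall m, alpha m.+1 w <> t) ->
  X x s w @[s --> within `[0, +oo[ (nbhs t)] --> X x t w.
Proof.
move=> t0 [n tn] nt.
have [[m /andP[mt tm]]|] := jump_interval_exists w t0; last first.
  by move=> /(_ n); rewrite leNgt tn.
(* For m = 0, i.e. at t = 0 in particular, the bound comes from s >= 0; for
   m > 0 it holds near t because t is not the jump time alpha m. *)
have smt : \forall s \near within `[0, +oo[ (nbhs t), alpha m w <= s.
  case: m mt {tm} => [|m] mt.
    apply: filterS (withinT _ _) => s /=.
    by rewrite in_itv/= alpha0 andbT.
  have mlt : alpha m.+1 w < t by rewrite lt_neqAle mt andbT; apply/eqP.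
  by apply: cvg_within; apply: filterS (lt_nbhsr mlt) => s /ltW.
rewrite (@jump_process_in x m t) ?mt//.
apply: (@cvg_trans _ ((fun s => T (s - alpha m w) (chain x m w)) @
  (within `[0, +oo[ (nbhs t)))).
  apply: near_eq_cvg; near=> s.
  rewrite (@jump_process_in x m)//; apply/andP; split; first by near: s.
  by near: s; apply: cvg_within; exact: lt_nbhsl.
by apply: flow_cvg => //; exact: cvg_within.
Unshelve. all: by end_near. Qed.

End jump_paths.

(** * Measurability of the jump process *)

Lemma flow_jointly_continuous {R : realType} {V : normedModType R}
    (T : R -> V -> V) :
  time_continuous T -> contractive T ->
  continuous (fun p : R * V => T (Num.max p.1 0) p.2).
Proof.
move=> Tcont Tcontr [t v]; apply/cvgrPdist_lt => e e0 /=.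
have e20 : 0 < e / 2 by rewrite divr_gt0.
have /cvgrPdist_lt/(_ _ e20) := @semigroup_continuous _ _ _ Tcont v t.
rewrite near_simpl => Tt.
near=> p.
(* Compare first the two points at the same time, by contractivity, then the
   two times at the fixed point v. *)
rewrite [e]splitr -(subrKA (T (Num.max p.1 0) v)).
rewrite (le_lt_trans (ler_normD _ _))// ltrD//; last first.
  rewrite (le_lt_trans (Tcontr _ _ _ _))//; first by rewrite le_max lexx orbT.
  near: p; move: e20; apply/cvgrPdist_lt: (e / 2); exact: cvg_snd.
near: p.
exact: (@cvg_fst R V (nbhs t) (nbhs v) _ _ Tt).
Unshelve. all: by end_near. Qed.

Lemma alpha_measurable {d} {Om : measurableType d} {R : realType}
    (beta : nat -> Om -> R) m :
  (forall k, measurable_fun setT (beta k)) ->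
  measurable_fun setT (alpha beta m).
Proof. by move=> mbeta; apply: measurable_sum => k. Qed.

Lemma alpha_itv_measurable {d} {Om : measurableType d} {R : realType}
    (beta : nat -> Om -> R) m (t : R) :
  (forall k, measurable_fun setT (beta k)) ->
  measurable [set w | alpha beta m w <= t < alpha beta m.+1 w].
Proof.
move=> mbeta; rewrite -[X in measurable X]setTI.
have ma k := alpha_measurable k mbeta.
have -> : [set w | alpha beta m w <= t < alpha beta m.+1 w] =
  (alpha beta m @^-1` `]-oo, t]) `&` (alpha beta m.+1 @^-1` `]t, +oo[).
  by apply/seteqP; split=> w /=; rewrite !in_itv/= andbT => /andP.
by rewrite setTI; apply: measurableI; rewrite -[X in measurable X]setTI;
  apply: ma.
Qed.

Section jump_measurability.
Context {d} {Om : measurableType d} {R : realType} {V : normedModType R}.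
Variables (T : R -> V -> V) (eta : nat -> Om -> V) (beta : nat -> Om -> R)
  (x : Om -> V).
Hypothesis V_separable : separable V.
Hypothesis beta_gt0 : forall m w, 0 < beta m w.
Hypothesis T_continuous : time_continuous T.
Hypothesis T_contractive : contractive T.
Hypothesis beta_measurable : forall k, measurable_fun setT (beta k).
Hypothesis eta_measurable :
  forall k, measurable_fun setT (eta k : Om -> borelType V).
Hypothesis x_measurable : measurable_fun setT (x : Om -> borelType V).

Let measurable_flow (s : Om -> R) (y : Om -> V) :
  measurable_fun setT s -> measurable_fun setT (y : Om -> borelType V) ->
  measurable_fun setT
    ((fun w => T (Num.max (s w) 0) (y w)) : Om -> borelType V).
Proof.
move=> ms my; apply: (measurable_comp2 (separable_real R) V_separable
  (flow_jointly_continuous T_continuous T_contractive)) => U oU.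
- rewrite -[X in measurable X]setTI; apply: ms => //; exact: open_measurable.
- by rewrite -[X in measurable X]setTI; move: U oU; apply/borel_measurableP.
Qed.

Lemma jump_chain_measurable m :
  measurable_fun setT (jump_chain T eta beta x m : Om -> borelType V).
Proof.
elim: m => //= m IH.
have mT := measurable_flow (beta_measurable m) IH.
apply: (@measurable_comp2 _ _ _ _ _ _ (fun z : V * V => z.1 + z.2)
    (fun w => T (beta m w) (jump_chain T eta beta x m w)) (eta m)
    V_separable V_separable (@add_continuous V)) => U oU;
  rewrite -[X in measurable X]setTI; move: U oU; apply/borel_measurableP => //.
apply: eq_measurable_fun mT => w _ /=.
by rewrite (max_idPl _)// ltW.
Qed.

Lemma jump_process_measurable (t : R) :
  measurable_fun setT (jump_process T eta beta x t : Om -> borelType V).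
Proof.
apply/borel_measurableP => // U oU; rewrite setTI.
pose J m := [set w | alpha beta m w <= t < alpha beta m.+1 w].
have mJ m : measurable (J m) by exact: alpha_itv_measurable.
pose Y m w := T (Num.max (t - alpha beta m w) 0) (jump_chain T eta beta x m w).
have mY m : measurable (Y m @^-1` U).
  rewrite -[X in measurable X]setTI.
  move: (U) oU; apply/borel_measurableP => //.
  apply: measurable_flow; last exact: jump_chain_measurable.
  by apply: measurable_funB => //; exact: alpha_measurable.
have -> : jump_process T eta beta x t @^-1` U =
    \bigcup_m (J m `&` Y m @^-1` U) `|`
    (\bigcap_m ~` J m) `&` [set _ | U 0].
  apply/seteqP; split=> w /=.
    have [[m mt]|nJ] := pselect (exists m, J m w).
      rewrite (jump_process_in _ _ _ _ mt)// => Uw; left; exists m => //.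
      split=> //=; rewrite /Y (max_idPl _)// subr_ge0.
      by case/andP: mt.
    have nJ' m : ~ J m w by move=> mt; apply: nJ; exists m.
    by rewrite jump_process_out// => U0; right; split=> // m _; exact: nJ'.
  move=> [[m _ [mt]]|[nJ U0]].
    rewrite (jump_process_in _ _ _ _ mt)//= /Y (max_idPl _)// subr_ge0.
    by case/andP: mt.
  by rewrite jump_process_out// => m; exact: nJ.
apply: measurableU.
  by apply: bigcup_measurable => m _; exact: measurableI.
apply: measurableI; last first.
  have [U0|nU0] := pselect (U 0).
    by have -> : [set _ | U 0] = setT :> set Om by apply/seteqP; split.
  by have -> : [set _ | U 0] = set0 :> set Om by apply/seteqP; split.
by apply: bigcap_measurable => [|m _]; [exists 0%N|exact: measurableC].
Qed.

End jump_measurability.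

(** * The exponential clock *)

Lemma independent_finite_prefix {d d'} {Om : measurableType d}
    {U : measurableType d'} {R : realType} (P : probability Om R)
    (Y : nat -> Om -> U) n (E : nat -> set U) :
  mutually_independent P Y -> (forall i, measurable (E i)) ->
  P (\bigcap_(i in `I_n) Y i @^-1` E i) = (\prod_(i < n) P (Y i @^-1` E i))%E.
Proof.
move=> indepY mE; pose J := [fset i in iota 0 n]%fset.
have memJ i : (i \in J) = (i < n)%N by rewrite inE mem_iota.
have := indepY J (fun i => Y i @^-1` E i) _.
rewrite (_ : [set` J] = `I_n); last first.
  by apply/seteqP; split=> i /=; rewrite memJ.
move=> -> => [|i _]; last by exists (E i); rewrite ?setTI.
rewrite -(big_mkord xpredT (fun i => P (Y i @^-1` E i))) /index_iota subn0.
apply: perm_big; apply: uniq_perm; rewrite ?fset_uniq ?iota_uniq// => i.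
by rewrite memJ mem_iota.
Qed.

Lemma probability_exponential_itv0c {d} {Om : measurableType d} {R : realType}
    (P : probability Om R) (theta : R) (b : {RV P >-> R}) (c : R) :
  0 < theta -> exponentially_distributed theta b -> 0 < c ->
  P (b @^-1` `[0, c]) = (1 - expR (- theta * c))%:E.
Proof.
move=> theta0 expb c0; rewrite EFinB -exponential_prob_itv0c//.
by rewrite -expb//; exact: measurable_itv.
Qed.

Lemma exponential_no_atom {R : realType} (theta t : R) :
  exponential_prob theta [set t] = 0%E.
Proof. by rewrite /exponential_prob integral_set1. Qed.

(** If no jump time exceeds c, every waiting time lies in [0, c]; by
independence n of them do so with probability (1 - exp (- theta c)) ^ n. *)
Lemma alpha_unbounded {d} {Om : measurableType d} {R : realType}
    (P : probability Om R) (theta : R) (beta : nat -> {RV P >-> R}) :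
  0 < theta -> (forall m w, 0 < beta m w) ->
  mutually_independent P beta ->
  (forall m, exponentially_distributed theta (beta m)) ->
  {ae P, forall w, forall c, exists m, c < alpha beta m w}.
Proof.
move=> theta0 beta0 ibeta ebeta.
pose N (c : nat) := \bigcap_k beta k @^-1` `[0, c.+1%:R].
have mN k (c : nat) : measurable (beta k @^-1` `[0, c.+1%:R]).
  by rewrite -[X in measurable X]setTI; exact: measurable_funP.
have N0 c : P.-negligible (N c).
  apply/negligibleP; first by apply: bigcap_measurable => //; exists 0%N.
  apply/eqP; rewrite eq_le measure_ge0 andbT.
  pose q : R := 1 - expR (- theta * c.+1%:R).
  have q0 : 0 <= q by rewrite subr_ge0 expR_le1 mulNr oppr_le0 mulr_ge0// ltW.
  have q1 : `|q| < 1 by rewrite ger0_norm// ltrBlDr ltrDl expR_gt0.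
  have PN n : (P (N c) <= (q ^+ n)%:E)%E.
    apply: (@le_trans _ _ (P (\bigcap_(k in `I_n) beta k @^-1` `[0, c.+1%:R]))).
      apply: le_measure; rewrite ?inE//.
      - by apply: bigcap_measurable => //; exists 0%N.
      - by apply: fin_bigcap_measurable => //; exact: finite_II.
      - by move=> w Nw k _; exact: Nw.
    rewrite (independent_finite_prefix n ibeta (fun=> measurable_itv _)).
    rewrite (eq_bigr (fun=> q%:E)); last first.
      by move=> i _; rewrite (probability_exponential_itv0c theta0 (ebeta i)).
    by rewrite prodEFin big_const_ord iter_mulr_1.
  apply/lee_addgt0Pr => e e0; rewrite add0e.
  have /cvgrPdist_lt/(_ _ e0)[n _ /(_ n (leqnn n))] := cvg_expr q1.
  rewrite /= sub0r normrN ger0_norm ?exprn_ge0// => qe.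
  by rewrite (le_trans (PN n))// lee_fin ltW.
apply: (negligibleS _ (negligible_bigcup N0)) => w /= /existsNP[c /forallNP wc].
have {}wc m : alpha beta m w <= c by rewrite leNgt; apply/negP/wc.
(* The jump time after the k-th waiting time bounds it, and [trunc c + 1]
   exceeds c. *)
exists (Num.trunc c) => // k _ /=; rewrite in_itv/= ltW//=.
rewrite (le_trans _ (ltW (truncnS_gt _)))// (le_trans _ (wc k.+1))//.
by rewrite alphaS lerDr alpha_ge0.
Qed.

(** Both sides are finite measures in A that agree on the pi-system G. *)
Lemma independent_of_generated {d} {Om : measurableType d} {R : realType}
    (P : probability Om R) (G : set (set Om)) (C : set Om) :
  G `<=` measurable -> setI_closed G -> G setT -> measurable C ->
  (forall A, G A -> P (A `&` C) = (P A * P C)%E) ->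
  forall A, <<s G >> A -> P (A `&` C) = (P A * P C)%E.
Proof.
move=> Gm GI GT mC GC A sA.
have PC0 : 0 <= fine (P C) by rewrite fine_ge0.
have PCE : (NngNum PC0)%:num%:E = P C by rewrite /= fineK// fin_num_measure.
have mscaleE B : mscale (NngNum PC0) P B = (P B * P C)%E.
  by rewrite /mscale /= PCE muleC.
rewrite -mscaleE; apply: (@g_sigma_algebra_measure_unique _ R Om G Gm
  (fun=> setT) (fun=> GT) _ (mrestr P mC) (mscale (NngNum PC0) P) GI _ _ A sA).
- by rewrite bigcup_const.
- by move=> B GB; rewrite [RHS]mscaleE -GC.
- move=> k; apply: le_lt_trans (ltry 1).
  by apply: probability_le1; exact: measurableI.
Qed.

(** The pi-system consists of the cylinders over the first m waiting times,
which generate a sigma-algebra that makes [alpha beta m] measurable. *)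
Lemma alpha_independent_next {d} {Om : measurableType d} {R : realType}
    (P : probability Om R) (beta : nat -> {RV P >-> R}) m (A B : set R) :
  mutually_independent P beta -> measurable A -> measurable B ->
  P (alpha beta m @^-1` A `&` beta m @^-1` B) =
  (P (alpha beta m @^-1` A) * P (beta m @^-1` B))%E.
Proof.
move=> ibeta mA mB.
pose G : set (set Om) := [set S | exists2 E : nat -> set R,
  forall i, measurable (E i) & S = \bigcap_(i in `I_m) beta i @^-1` E i].
have mpre i (E : set R) : measurable E -> measurable (beta i @^-1` E).
  by move=> mE; rewrite -[X in measurable X]setTI; exact: measurable_funP.
apply: (@independent_of_generated _ _ _ P G) => //.
- move=> _ [E mE ->].
  apply: fin_bigcap_measurable => [|i _]; first exact: finite_II.
  exact: mpre.
- move=> _ _ [E mE ->] [E' mE' ->]; exists (fun i => E i `&` E' i) => [i|].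
    exact: measurableI.
  by rewrite -bigcapI.
- by exists (fun=> setT) => //; apply/seteqP; split.
- exact: mpre.
- move=> _ [E mE ->].
  (* Adding the factor B at index m turns the intersection into a cylinder over
     the first m + 1 waiting times. *)
  pose E1 i := if i == m then B else E i.
  have mE1 i : measurable (E1 i) by rewrite /E1; case: ifP.
  have E1i i : (i < m)%N -> E1 i = E i by rewrite /E1 => /ltn_eqF ->.
  have E1m : E1 m = B by rewrite /E1 eqxx.
  have prodE : (\prod_(i < m) P (beta i @^-1` E1 i) =
      P (\bigcap_(i in `I_m) beta i @^-1` E i))%E.
    rewrite (independent_finite_prefix m ibeta mE).
    by apply: eq_bigr => i _; rewrite E1i.
  have := independent_finite_prefix m.+1 ibeta mE1.
  rewrite big_ord_recr /= prodE E1m => <-; congr (P _).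
  apply/seteqP; split=> w /=.
    move=> [EB Bw] i /=; rewrite ltnS leq_eqVlt => /predU1P[->|im].
      by rewrite E1m.
    by rewrite E1i//; exact: EB.
  move=> EB; split=> [i im /=|]; last by have := EB m (ltnSn m); rewrite /= E1m.
  by rewrite -(E1i i im); apply: EB; rewrite /= ltnS ltnW.
- have : measurable_fun setT (alpha beta m : g_sigma_algebraType G -> R).
    apply: (@measurable_sum _ (g_sigma_algebraType G)) => i _ E mE.
    rewrite setTI; apply: sub_sigma_algebra.
    exists (fun j : nat => if j == i :> nat then E else setT).
      by move=> j; case: ifP.
    apply/seteqP; split=> w /= Ew.
      by move=> j _ /=; case: ifPn => // /eqP ->.
    by have := Ew i (ltn_ord i); rewrite /= eqxx.
  by move=> /(_ measurableT _ mA); rewrite setTI.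
Qed.

(** The joint law of the m-th jump time and the next waiting time is a product
measure, and every section of the line u + v = t is a single point, which the
exponential law does not charge. *)
Lemma alpha_no_atom {d} {Om : measurableType d} {R : realType}
    (P : probability Om R) (theta : R) (beta : nat -> {RV P >-> R}) m (t : R) :
  mutually_independent P beta ->
  exponentially_distributed theta (beta m) ->
  P [set w | alpha beta m.+1 w = t] = 0%E.
Proof.
move=> ibeta ebeta.
have ma : measurable_fun setT (alpha beta m).
  by apply: alpha_measurable => k; exact: measurable_funPT.
pose a : {RV P >-> R} := mfun_Sub (mem_set ma).
pose ab : {RV P >-> (R * R)%type} :=
  mfun_Sub (mem_set (measurable_fun_pair ma (measurable_funPT (beta m)))).
pose S : set (R * R) := [set p | p.1 + p.2 = t].
have mS : measurable S.
  have -> : S = (fun p : R * R => p.1 + p.2) @^-1` [set t] by [].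
  rewrite -[X in measurable X]setTI.
  apply: measurable_funD => //; exact: measurable_set1.
have -> : [set w | alpha beta m.+1 w = t] = ab @^-1` S.
  by apply/seteqP; split=> w /=; rewrite alphaS.
have joint A B : measurable A -> measurable B ->
    distribution P ab (A `*` B) =
    (distribution P a A * distribution P (beta m) B)%E.
  by move=> mA mB; exact: (alpha_independent_next m ibeta mA mB).
rewrite -[LHS](product_measure_unique joint mS).
apply: integral0_eq => u _ /=.
rewrite (_ : xsection S u = [set t - u]).
  by rewrite ebeta// exponential_no_atom.
apply/seteqP; split=> v; rewrite /xsection /= inE /S /=.
  by move=> <-; rewrite addrC addKr.
by move=> ->; rewrite addrC subrK.
Qed.

(** * Feller property and e-property *)

Section jump_expectations.
Context {d} {Om : measurableType d} {R : realType} {V : normedModType R}.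
Variables (P : probability Om R) (T : R -> V -> V)
  (eta : nat -> {RV P >-> borelType V}) (beta : nat -> {RV P >-> R}).
Hypothesis V_separable : separable V.
Hypothesis beta_gt0 : forall m w, 0 < beta m w.
Hypothesis T_continuous : time_continuous T.
Hypothesis T_contractive : contractive T.

Local Notation X x := (jump_process T eta beta x).

Let mX (x : Om -> V) t : measurable_fun setT (x : Om -> borelType V) ->
  measurable_fun setT (X x t : Om -> borelType V).
Proof.
move=> mx; apply: jump_process_measurable => // k; exact: measurable_funPT.
Qed.

Lemma jump_process_feller : feller (Q P T eta beta).
Proof.
move=> t psi t0 [/bounded_fun_normP[M psiM] cpsi].
have mpsi v : measurable_fun setT (psi \o X (cst v) t).
  by apply: continuous_borel_measurable => //; exact: mX.
split.
  apply/bounded_fun_normP; exists M => v /=.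
  have := @expectation_dist_le _ _ _ P (psi \o X (cst v) t) (cst 0) M M
    (mpsi v) (measurable_cst _) (fun=> psiM _).
  rewrite expectation_cst /= subr0; apply => [w|w].
    by rewrite normr0 (le_trans _ (psiM 0)).
  by rewrite subr0.
move=> v.
have := @cvg_within_sequences _ _ setT (Q P T eta beta t psi) v
  (Q P T eta beta t psi v).
rewrite withinET; apply => u _ uv.
apply: (@expectation_cvg_bounded _ _ _ _ _ _ M) => [n||n w|].
- exact: mpsi.
- exact: mpsi.
- exact: psiM.
apply: aeW => w; apply: continuous_cvg; first exact: cpsi.
apply/cvgrPdist_le => e e0; have /cvgrPdist_le/(_ _ e0) := uv.
apply: filterS => n /=; apply: le_trans.
exact: jump_process_contractive.
Qed.

(** The pathwise contraction bounds the difference of the expectations by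
k |v - v'| uniformly in t, where k is a positive Lipschitz constant of psi. *)
Lemma jump_process_e_property : e_property (Q P T eta beta).
Proof.
move=> psi v e [/bounded_fun_normP[M psiM] /pinfty_ex_gt0[k k0 lpsi]] e0.
have cpsi : continuous psi.
  move=> u; apply/cvgrPdist_lt => r r0.
  have kr0 : 0 < r / k by rewrite divr_gt0.
  apply: filterS (nbhsx_ballx u _ kr0) => u'; rewrite -ball_normE /= => uu'.
  rewrite (le_lt_trans (lpsi (u, u') _))//=.
  by rewrite mulrC -ltr_pdivlMr.
have mpsi u t : measurable_fun setT (psi \o X (cst u) t).
  by apply: continuous_borel_measurable => //; exact: mX.
exists (e / k); first by rewrite divr_gt0.
move=> v' vv' t t0.
apply: (@le_lt_trans _ _ (k * `|v' - v|)); last first.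
  by rewrite mulrC -ltr_pdivlMr.
apply: (@expectation_dist_le _ _ _ _ (psi \o X (cst v) t)
  (psi \o X (cst v') t) M) => [||w|w|w /=]; [exact: mpsi|exact: mpsi| | |];
  try exact: psiM.
rewrite (le_trans (lpsi (X (cst v) t w, X (cst v') t w) _))//=.
rewrite (ler_wpM2l (ltW k0))//.
rewrite (distrC v').
exact: (jump_process_contractive eta beta_gt0 T_contractive (cst v) (cst v')).
Qed.

End jump_expectations.

(** * Almost sure and stochastic continuity *)

Section stochastic_continuity.
Context {d} {Om : measurableType d} {R : realType} {V : normedModType R}.
Variables (P : probability Om R) (T : R -> V -> V)
  (eta : nat -> {RV P >-> borelType V}) (theta : R)
  (beta : nat -> {RV P >-> R}) (x : Om -> V).
Hypothesis V_separable : separable V.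
Hypothesis theta_gt0 : 0 < theta.
Hypothesis beta_gt0 : forall m w, 0 < beta m w.
Hypothesis beta_independent : mutually_independent P beta.
Hypothesis beta_exponential :
  forall m, exponentially_distributed theta (beta m).
Hypothesis T_semigroup : semigroup T.
Hypothesis T_continuous : time_continuous T.
Hypothesis T_contractive : contractive T.
Hypothesis x_measurable : measurable_fun setT (x : Om -> borelType V).

Local Notation X := (jump_process T eta beta x).

Let mX t : measurable_fun setT (X t : Om -> borelType V).
Proof. apply: jump_process_measurable => // k; exact: measurable_funPT. Qed.

Let noexpl := alpha_unbounded theta_gt0 beta_gt0 beta_independent
  beta_exponential.

Lemma jump_process_cadlag : {ae P, forall w, cadlag (fun t => X t w)}.
Proof.
apply: filterS noexpl => w unb; split=> t t0.
  exact: jump_process_right_continuous.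
exact: jump_process_left_limit.
Qed.

Lemma jump_process_continuous_ae (t : R) : 0 <= t ->
  {ae P, forall w, X s w @[s --> within `[0, +oo[ (nbhs t)] --> X t w}.
Proof.
move=> t0.
have nojump : {ae P, forall w, forall m, alpha beta m.+1 w <> t}.
  have N0 m : P.-negligible [set w | alpha beta m.+1 w = t].
    apply/negligibleP; last first.
      exact: (alpha_no_atom t beta_independent (beta_exponential m)).
    have ma : measurable_fun setT (alpha beta m.+1).
      by apply: alpha_measurable => k; exact: measurable_funPT.
    by have := ma measurableT _ (measurable_set1 t); rewrite setTI.
  apply: negligibleS (negligible_bigcup N0) => w /= /existsNP[m /contrapT mt].
  by exists m.
apply: filterS2 noexpl nojump => w unb nj.
exact: jump_process_continuous.
Qed.

Lemma jump_process_sequence_cvg_ae (t : R) (u : nat -> R) : 0 <= t ->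
  (forall n, `[0, +oo[%classic (u n)) -> u n @[n --> \oo] --> t ->
  {ae P, forall w, X (u n) w @[n --> \oo] --> X t w}.
Proof.
move=> t0 u0 ut; apply: filterS (jump_process_continuous_ae t0) => w.
apply: cvg_comp => A /ut [N _ NA]; exists N => // n Nn.
exact: NA n Nn (u0 n).
Qed.

Lemma expectation_jump_process_continuous psi : Cb psi ->
  {within `[0, +oo[, continuous (fun t : R => fine 'E_P[fun w => psi (X t w)])}.
Proof.
move=> [/bounded_fun_normP[M psiM] cpsi].
apply/subspace_continuousP => t; rewrite /= in_itv/= andbT => t0.
apply: cvg_within_sequences => u u0 ut.
have mpsi s : measurable_fun setT (psi \o X s).
  by apply: continuous_borel_measurable.
apply: (@expectation_cvg_bounded _ _ _ _ (fun n => psi \o X (u n)) (psi \o X t)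
  M) => [n||n w|]; [exact: mpsi|exact: mpsi|exact: psiM|].
apply: filterS (jump_process_sequence_cvg_ae t0 u0 ut) => w.
by move=> Xu; apply: continuous_cvg => //; exact: cpsi.
Qed.

(** The probability is the expectation of an indicator, and almost sure
convergence makes these indicators eventually 0. *)
Lemma jump_process_continuous_in_probability : continuous_in_probability P X.
Proof.
move=> t e t0 e0.
have mD s : measurable [set w | e < `|X s w - X t w|].
  have mXY : measurable_fun setT ((fun w => X s w - X t w) : Om -> borelType V).
    apply: (@measurable_comp2 _ _ _ _ _ _ (fun z : V * V => z.1 - z.2)
      (X s) (X t) V_separable V_separable) => [|U oU|U oU].
    - move=> z; apply: cvgB; [exact: cvg_fst|exact: cvg_snd].
    - by rewrite -[X in measurable X]setTI; move: U oU; apply/borel_measurableP.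
    - by rewrite -[X in measurable X]setTI; move: U oU; apply/borel_measurableP.
  have := continuous_borel_measurable (@norm_continuous _ V) mXY.
  move=> /(_ measurableT `]e, +oo[%classic (measurable_itv _)).
  rewrite setTI; congr (measurable _).
  by apply/seteqP; split=> w /=; rewrite in_itv/= andbT.
have PE s : P [set w | e < `|X s w - X t w|] =
    (fine 'E_P[\1_[set w | e < `|X s w - X t w|]])%:E.
  by rewrite expectation_indic// fineK// fin_num_measure.
under eq_cvg do rewrite PE.
apply: cvg_EFin; first exact: nearW.
apply: cvg_within_sequences => u u0 ut.
have := @expectation_cvg_bounded _ _ _ P
  (fun n => \1_[set w | e < `|X (u n) w - X t w|]) (cst 0) 1.
rewrite expectation_cst; apply => [n||n w|].
- exact: measurable_indic.
- exact: measurable_cst.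
- by rewrite indicE; case: (_ \in _); rewrite ?normr1 ?normr0.
apply: filterS (jump_process_sequence_cvg_ae t0 u0 ut) => w.
move=> /cvgrPdist_le/(_ _ e0) ue; apply: cvg_near_cst.
apply: filterS ue => n /= ue.
by rewrite indicE memNset//= distrC ltNge ue.
Qed.

End stochastic_continuity.

(** * The completed natural filtration *)

Lemma symdiff_null_ae {d} {Om : measurableType d} {R : realType}
    (P : probability Om R) (A B : set Om) : measurable A -> measurable B ->
  P (A `+` B) = 0%E <-> {ae P, forall w, A w <-> B w}.
Proof.
move=> mA mB.
have mAB : measurable (A `+` B) by apply: measurableU; exact: measurableD.
have -> : P (A `+` B) = 0%E <-> P.-negligible (A `+` B).
  by split=> [?|?]; apply/negligibleP.
suff -> : A `+` B = ~` [set w | A w <-> B w] by [].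
apply/seteqP; split=> w /=.
  by move=> [[Aw nBw]|[Bw nAw]] [AB BA]; [apply/nBw/AB|apply/nAw/BA].
move=> nAB; have [Aw|nAw] := pselect (A w); have [Bw|nBw] := pselect (B w).
- by exfalso; apply: nAB.
- by left.
- by right.
- by exfalso; apply: nAB; split.
Qed.

Lemma sigma_gen_measurable {d d'} {Om : measurableType d}
    {U : measurableType d'} {I : Type} (D : set I) (Y : I -> Om -> U) :
  (forall i, D i -> measurable_fun setT (Y i)) ->
  sigma_gen D Y `<=` measurable.
Proof.
move=> mY; apply: smallest_sub; first exact: sigma_algebra_measurable.
by move=> _ [i Di [B mB <-]]; exact: mY.
Qed.

(** Almost sure equivalence is stable under complements and countable unions
pointwise, which avoids computing with symmetric differences. *)
Lemma sigma_completionP {d} {Om : measurableType d} {R : realType}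
    (P : probability Om R) (G : set (set Om)) (A : set Om) :
  G `<=` measurable ->
  sigma_completion P G A <->
  measurable A /\ exists2 B, G B & {ae P, forall w, A w <-> B w}.
Proof.
move=> Gm; split=> -[mA [B GB AB]]; split=> //; exists B => //.
  by apply/symdiff_null_ae => //; exact: Gm.
by apply/symdiff_null_ae => //; exact: Gm.
Qed.

Lemma sigma_algebra_completion {d} {Om : measurableType d} {R : realType}
    (P : probability Om R) (G : set (set Om)) :
  G `<=` measurable -> sigma_algebra setT G ->
  sigma_algebra setT (sigma_completion P G).
Proof.
move=> Gm [G0 GC GU]; split.
- apply/sigma_completionP => //; split=> //; exists set0 => //.
  by apply: aeW.
- move=> A /(sigma_completionP _ _ Gm)[mA [B GB AB]].
  apply/sigma_completionP => //; split; first exact: measurableD.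
  exists (setT `\` B); first exact: GC.
  by apply: filterS AB => w [AB BA]; split=> -[_ nw]; split=> // /[dup] ? ?;
    apply: nw; [exact: BA|exact: AB].
- move=> A GA.
  have /choice[B AB] : forall n, exists B,
      G B /\ {ae P, forall w, A n w <-> B w}.
    by move=> n; have /(sigma_completionP _ _ Gm)[_ [B ? ?]] := GA n; exists B.
  apply/sigma_completionP => //; split.
    by apply: bigcup_measurable => n _; have [] := GA n.
  exists (\bigcup_n B n); first by apply: GU => n; case: (AB n).
  have := ae_foralln (fun n => (AB n).2).
  apply: filterS => w wAB.
  by split=> -[n _ nw]; exists n => //; apply/wAB.
Qed.

Lemma natural_filtration_filtration {d d'} {Om : measurableType d}
    {U : measurableType d'} {R : realType} (P : probability Om R)
    (Y : R -> Om -> U) :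
  (forall t, measurable_fun setT (Y t)) -> filtration (natural_filtration P Y).
Proof.
move=> mY; split=> [t t0|s t s0 st].
  split; last by move=> A [].
  apply: sigma_algebra_completion; first exact: sigma_gen_measurable.
  exact: smallest_sigma_algebra.
move=> A [mA [B sB AB]]; split=> //; exists B => //.
move: sB; apply: sub_smallest2r.
  exact: smallest_sigma_algebra.
apply: bigcup_subset => r /=; rewrite !in_itv/= => /andP[-> /=] rs.
exact: le_trans rs st.
Qed.

Lemma natural_filtration_complete {d d'} {Om : measurableType d}
    {U : measurableType d'} {R : realType} (P : probability Om R)
    (Y : R -> Om -> U) :
  measure_is_complete P -> complete_filtration P (natural_filtration P Y).
Proof.
move=> cP t t0 N nN; split; first exact: cP.
exists set0; first by have [] := smallest_sigma_algebra setT
  (\bigcup_(i in `[0, t]) g_sigma_algebra_preimage (Y i)).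
by rewrite setY0; apply/negligibleP => //; exact: cP.
Qed.

(** If on the event E each variable indexed by D' is a function of one indexed
by D, then every event generated by the former has the same trace on E as one
generated by the latter: for any set E, the events B with such a partner B'
form a sigma-algebra, and the hypothesis provides partners of the generators. *)
Lemma sigma_gen_trace {d d'} {Om : measurableType d}
    {U : measurableType d'} {I : Type} (D D' : set I) (Y : I -> Om -> U)
    (E : set Om) :
  (forall i, D' i -> exists j (phi : U -> U),
    [/\ D j, measurable_fun setT phi & forall w, E w -> Y i w = phi (Y j w)]) ->
  forall B, sigma_gen D' Y B ->
    exists2 B', sigma_gen D Y B' & forall w, E w -> (B w <-> B' w).
Proof.
move=> DD'.
have [s0 sC sU] : sigma_algebra setT (sigma_gen D Y).
  exact: smallest_sigma_algebra.
apply: smallest_sub; first split.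
- by exists set0.
- move=> A [B sB AB]; exists (setT `\` B); first exact: sC.
  by move=> w Ew; have [AB1 BA1] := AB w Ew; split=> -[_ nw]; split=> // ?;
    apply: nw; [exact: BA1|exact: AB1].
- move=> A sA.
  have /choice[B AB] : forall n, exists B,
      sigma_gen D Y B /\ forall w, E w -> (A n w <-> B w).
    by move=> n; have [B ? ?] := sA n; exists B.
  exists (\bigcup_n B n); first by apply: sU => n; case: (AB n).
  by move=> w Ew; split=> -[n _ nw]; exists n => //; apply/((AB n).2 w Ew).
- move=> _ [i D'i [B mB <-]]; have [j [phi [Dj mphi Yphi]]] := DD' i D'i.
  exists (Y j @^-1` (phi @^-1` B)).
    apply: sub_sigma_algebra; exists j => //; exists (phi @^-1` B).
      by rewrite -[X in measurable X]setTI; exact: mphi.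
    by rewrite setTI.
  by move=> w Ew; rewrite /= Yphi//; split=> [[]|].
Qed.

(** The hypothesis on Y says that almost every path follows the flow for a short
time after t, for a duration depending on the path. The sets B'_n below are
measurable at time t and agree with A on the event that this duration exceeds
1/(n+1); these events increase to a set of full measure, so that A is almost
surely the limit inferior of the B'_n. *)
Lemma natural_filtration_right_continuous {d} {Om : measurableType d}
    {R : realType} {V : normedModType R} (P : probability Om R)
    (T : R -> V -> V) (Y : R -> Om -> V) :
  contractive T ->
  (forall t, measurable_fun setT (Y t : Om -> borelType V)) ->
  (forall t, 0 <= t -> {ae P, forall w, exists2 u, t < u &
    forall s, t <= s -> s < u -> Y s w = T (s - t) (Y t w)}) ->
  right_continuous_filtration
    (natural_filtration P (Y : R -> Om -> borelType V)).
Proof.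
move=> Tcontr mY flow t t0.
have [_ Fmono] := natural_filtration_filtration P mY.
apply/seteqP; split=> [A FA s|A FA].
  by rewrite /= in_itv/= andbT => ts; exact: Fmono (ltW ts) _ FA.
pose u (n : nat) : R := t + n.+1%:R^-1.
have ut n : t < u n by rewrite ltrDl invr_gt0.
have FuA n : natural_filtration P (Y : R -> Om -> borelType V) (u n) A.
  by apply: FA; rewrite /= in_itv/= ut.
have sm s : sigma_gen `[0, s] (Y : R -> Om -> borelType V) `<=` measurable.
  exact: sigma_gen_measurable.
pose E n := [set w | forall s, t <= s -> s <= u n -> Y s w = T (s - t) (Y t w)].
have /choice[B' B'P] : forall n, exists B',
    sigma_gen `[0, t] (Y : R -> Om -> borelType V) B' /\
    {ae P, forall w, E n w -> (A w <-> B' w)}.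
  move=> n; have /(sigma_completionP _ _ (@sm _))[mA [B sB AB]] := FuA n.
  have [|B' sB' BB'] := @sigma_gen_trace _ _ _ _ _ `[0, t] `[0, u n]
      (Y : R -> Om -> borelType V) (E n) _ B sB.
    move=> s; rewrite /= in_itv/= => /andP[s0 su].
    have [st|ts] := leP s t.
      by exists s, id; split=> //; rewrite /= in_itv/= s0.
    exists t, (T (s - t)); split.
    - by rewrite /= in_itv/= t0 lexx.
    - apply/borel_measurableP => // O oO; rewrite setTI.
      apply: sub_sigma_algebra; apply: open_comp => // v _.
      apply/cvgrPdist_lt => e e0.
      apply: filterS (nbhsx_ballx v _ e0) => v'; rewrite -ball_normE /=.
      by apply: le_lt_trans; apply: Tcontr; rewrite subr_ge0 ltW.
    - by move=> w Ew; apply: Ew => //; exact: ltW.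
  exists B'; split=> //; apply: filterS AB => w AB Ew.
  by rewrite AB; exact: BB'.
have mA : measurable A by have [] := FuA 0%N.
apply/sigma_completionP => //; split=> //.
exists (\bigcup_N \bigcap_(n in [set n | (N <= n)%N]) B' n).
  pose S := g_sigma_algebraType (\bigcup_(i in `[0, t])
    g_sigma_algebra_preimage ((Y : R -> Om -> borelType V) i)).
  apply: (@bigcup_measurable _ S) => N _.
  apply: (@bigcap_measurable _ S) => [|n _]; first by exists N => /=.
  by have [] := B'P n.
apply: filterS2 (flow t t0) (ae_foralln (fun n => (B'P n).2)) => w.
move=> [r tr wr] AB'.
have [N uN] : exists N, forall n, (N <= n)%N -> u n < r.
  have rt0 : 0 < r - t by rewrite subr_gt0.
  have [N _ NP] := near_infty_natSinv_lt (PosNum rt0).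
  by exists N => n Nn; rewrite /u addrC -ltrBrDr; exact: NP.
have wE n : (N <= n)%N -> E n w.
  by move=> Nn s ts su; apply: wr => //; exact: le_lt_trans su (uN _ Nn).
split=> [Aw|[M _ B'M]].
  by exists N => // n Nn; apply/(AB' n (wE n Nn)).
have NM := leq_maxl N M.
by apply/(AB' _ (wE _ NM)); apply: B'M; exact: leq_maxr.
Qed.

(** * Progressive measurability *)

(** The first point to the right of s of the grid of mesh 1/(n+1), cut off at t
so that it stays among the times observed up to t. *)
Definition right_grid {R : realType} (t : R) (n : nat) (s : R) : R :=
  Num.min t ((Num.trunc (s * n.+1%:R)).+1%:R / n.+1%:R).

Lemma right_grid_bounds {R : realType} (t : R) n (s : R) : 0 <= s <= t ->
  s <= right_grid t n s <= Num.min t (s + n.+1%:R^-1).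
Proof.
move=> /andP[s0 st]; have n0 : 0 < n.+1%:R :> R by [].
have /andP[js sj] := truncn_itv (mulr_ge0 s0 (ltW n0)).
rewrite /right_grid; apply/andP; split.
  by rewrite le_min st ler_pdivlMr// ltW.
rewrite le_min ge_min lexx /= ge_min; apply/orP; right.
by rewrite ler_pdivrMr// mulrDl mulVf ?gt_eqF// -natr1 lerD2r.
Qed.

Lemma measurable_natural_filtration {d d'} {Om : measurableType d}
    {U : measurableType d'} {R : realType} (P : probability Om R)
    (Y : R -> Om -> U) (s t : R) (B : set U) :
  measurable_fun setT (Y s) -> measurable B -> 0 <= s <= t ->
  natural_filtration P Y t (Y s @^-1` B).
Proof.
move=> mY mB st; have mYB : measurable (Y s @^-1` B).
  by rewrite -[X in measurable X]setTI; exact: mY.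
split=> //; exists (Y s @^-1` B); last by rewrite setYK measure0.
apply: sub_sigma_algebra; exists s; first by rewrite /= in_itv.
by exists B; rewrite ?setTI.
Qed.

(** Sampling at [right_grid] gives step processes which are measurable on
[0, t] x Om, being countable unions of rectangles, and which converge at every
point by right-continuity of the paths. At s = t the grid point is t itself. *)
Lemma right_continuous_progressive {d} {Om : measurableType d}
    {R : realType} {V : normedModType R} (P : probability Om R)
    (Y : R -> Om -> V) :
  (forall t, measurable_fun setT (Y t : Om -> borelType V)) ->
  (forall t w, 0 <= t -> Y s w @[s --> t^'+] --> Y t w) ->
  progressive (natural_filtration P (Y : R -> Om -> borelType V))
    (Y : R -> Om -> borelType V).
Proof.
move=> mY Yr t t0.
set F := natural_filtration P (Y : R -> Om -> borelType V) t.
have mD : measurable (`[0, t]%classic `*` setT : set (R * g_sigma_algebraType F)).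
  by apply: measurableX => //; exact: measurable_itv.
apply: (measurable_cvg_pointwise
  (f_ := fun n (p : R * g_sigma_algebraType F) =>
    Y (right_grid t n p.1) p.2) mD).
- move=> n; apply/borel_measurableP => // O oO.
  have n0 : 0 < n.+1%:R :> R by [].
  pose I (j : nat) := `[0, t]%classic `&`
    `[j%:R / n.+1%:R, j.+1%:R / n.+1%:R[%classic : set R.
  pose q (j : nat) : R := Num.min t (j.+1%:R / n.+1%:R).
  rewrite (_ : _ `&` _ = \bigcup_j (I j `*` (Y (q j) @^-1` O))); last first.
    apply/seteqP; split=> -[s w] /=.
      move=> [[st _] Os]; exists (Num.trunc (s * n.+1%:R)) => //.
      split=> //=; split=> //.
      move: st; rewrite !in_itv /= => /andP[s0 _].
      rewrite in_itv /= ler_pdivrMr// ltr_pdivlMr//.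
      by apply: truncn_itv; rewrite mulr_ge0.
    move=> [j _ [[/= st sj] Os]]; split=> //.
    rewrite /right_grid (_ : Num.trunc _ = j)//.
    apply: truncn_def; move: sj.
    by rewrite in_itv /= ler_pdivrMr// ltr_pdivlMr.
  apply: bigcup_measurable => j _; apply: measurableX.
    by apply: measurableI; exact: measurable_itv.
  apply: sub_sigma_algebra; apply: measurable_natural_filtration => //.
    exact: sub_sigma_algebra.
  by rewrite /q le_min t0 ge_min lexx /= divr_ge0.
- move=> [s w] [/= + _]; rewrite in_itv /= => st.
  have s0 : 0 <= s by case/andP: st.
  apply/cvgrPdist_lt => e e0.
  have /cvgrPdist_lt/(_ _ e0)/nbhs_ballP[r /= r0 rY] := Yr s w s0.
  have [N _ Nr] := near_infty_natSinv_lt (PosNum r0).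
  exists N => // n Nn /=.
  have /andP[sg] := right_grid_bounds n st; rewrite le_min => /andP[_ gs].
  move: sg; rewrite le_eqVlt => /predU1P[<-|sg]; first by rewrite subrr normr0.
  apply: rY => //; rewrite -ball_normE /= ltr0_norm ?subr_lt0//.
  by rewrite opprB ltrBlDl (le_lt_trans gs)// ltrD2l; exact: Nr.
Qed.

(** * Feller property, path regularity and filtration of the jump process *)

Theorem lemma0p3p5 (R : realType) (d : measure_display)
    (Om : measurableType d) (P : probability Om R)
    (hP : measure_is_complete P)
    (V : completeNormedModType R) (hV : separable V)
    (T : R -> V -> V)
    (hT : semigroup T) (hTcont : time_continuous T) (hTcontr : contractive T)
    (eta : nat -> {RV P >-> borelType V}) (heta : iid eta)
    (theta : R) (htheta : 0 < theta)
    (beta : nat -> {RV P >-> R}) (hbeta_pos : forall m w, 0 < beta m w)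
    (hbeta : iid beta)
    (hbeta_exp : forall m, exponentially_distributed theta (beta m))
    (hindep : independent_systems P (sigma_gen setT eta) (sigma_gen setT beta)) :
  feller (Q P T eta beta) /\
  e_property (Q P T eta beta) /\
  forall x : {RV P >-> borelType V}, independent_initial eta beta x ->
    let X : R -> Om -> V := jump_process T eta beta x in
    let F : R -> set (set Om) :=
      natural_filtration P (X : R -> Om -> borelType V) in
    [/\ {ae P, forall w, cadlag (fun t => X t w)} /\
        continuous_in_probability P X,
        (forall psi, Cb psi ->
           {within `[0, +oo[, continuous
             (fun t : R => fine 'E_P[fun w => psi (X t w)])}) /\
        (forall psi v, Cb psi ->
           {within `[0, +oo[, continuous (fun t : R => Q P T eta beta t psi v)}),
        usual_conditions P F &
        progressive F (X : R -> Om -> borelType V)].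
Proof.
have ibeta := hbeta.1.
split; first exact: jump_process_feller.
split; first exact: jump_process_e_property.
move=> x _ X F.
have mX (t : R) : measurable_fun setT (X t : Om -> borelType V).
  by apply: jump_process_measurable => // k; exact: measurable_funPT.
split.
- split; first exact: (jump_process_cadlag _ _ htheta).
  apply: (jump_process_continuous_in_probability _ hV htheta) => //.
- split=> [psi|psi v] Cpsi.
    exact: (@expectation_jump_process_continuous _ _ _ _ P T eta theta beta x
      hV htheta hbeta_pos ibeta hbeta_exp hTcont hTcontr (measurable_funPT x)).
  have mv : measurable_fun setT (cst v : Om -> borelType V).
    exact: measurable_cst.
  exact: (@expectation_jump_process_continuous _ _ _ _ P T eta theta beta
    (cst v) hV htheta hbeta_pos ibeta hbeta_exp hTcont hTcontr mv).
- split.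
  + exact: natural_filtration_filtration.
  + exact: natural_filtration_complete.
  + apply: (natural_filtration_right_continuous hTcontr) => // t t0.
    apply: filterS (alpha_unbounded htheta hbeta_pos ibeta hbeta_exp) => w unb.
    have [[m /andP[mt tm]]|wt] := jump_interval_exists beta w t0.
      exists (alpha beta m.+1 w) => // s ts sm.
      exact: (jump_process_flow _ _ hT _ mt).
    (* Jump times all bounded by t are excluded outside the null event of
       explosion. *)
    by have [m] := unb t; rewrite ltNge wt.
- apply: right_continuous_progressive => // t w t0.
  exact: jump_process_right_continuous.
Qed.
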